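(* Colocal connectedness is a Whitney property; that is, if $X$ is a colocally connected continuum, then for each Whitney map $\mu : C(X) \to [0,\mu(X)]$ and each $t \in [0,\mu(X))$, the continuum $\mu^{-1}(t)$ is colocally connected.
   Context: A continuum is a nonempty compact connected metrizable space; all maps are continuous. A continuum $X$ is colocally connected if for each $x \in X$ and each neighborhood $V \subseteq X$ of $x$ there exists an open neighborhood $U \subseteq X$ of $x$ such that $x \in U \subseteq V$ and $X \setminus U$ is connected (the empty set is regarded as connected). For a continuum $X$, $C(X)$ denotes the space of all nonempty subcontinua of $X$ with the Hausdorff metric. A Whitney map is a continuous map $\mu : C(X) \to [0,\mu(X)]$ such that $\mu(\{x\})=0$ for each $x \in X$ and $\mu(A)<\mu(B)$ whenever $A,B \in C(X)$ and $A \subsetneq B$. It is well known that for each Whitney map $\mu$ and each $t \in [0,\mu(X)]$ the set $\mu^{-1}(t)$ (as a subspace of $C(X)$) is a continuum. A topological property $P$ is a Whitney property if whenever a continuum $X$ has property $P$, so does $\mu^{-1}(t)$ for each Whitney map $\mu$ for $C(X)$ and each $t \in [0,\mu(X))$. *)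

(* Defs.v *)
From HB Require Import structures.
From mathcomp Require Import all_boot all_order all_algebra.
From mathcomp Require Import all_classical all_reals all_analysis.

Set Implicit Arguments.
Unset Strict Implicit.
Unset Printing Implicit Defensive.

Import Order.TTheory GRing.Theory Num.Theory.
Import numFieldNormedType.Exports.

Local Open Scope classical_set_scope.
Local Open Scope ring_scope.

Definition metrizable (R : realType) (X : topologicalType) : Prop :=
  exists d : X -> X -> R,
    [/\ forall x y, d x y = 0 <-> x = y,
        forall x y, d x y = d y x,
        forall x y z, d x z <= d x y + d y z &
        forall (x : X) (V : set X),
          nbhs x V <-> exists2 e : R, 0 < e & [set y | d x y < e] `<=` V].

Definition continuum (R : realType) (X : topologicalType) : Prop :=
  [/\ [set: X] !=set0, compact [set: X], connected [set: X] & metrizable R X].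

(* The library's [connected] holds of the empty set ([connected0]). *)
Definition colocally_connected (R : realType) (X : topologicalType) : Prop :=
  continuum R X /\
  forall (x : X) (V : set X), nbhs x V ->
    exists U : set X, [/\ open U, U x, U `<=` V & connected (~` U)].

(* Metrizability of a subspace of a metric space is automatic. *)
Definition subcontinuum (X : topologicalType) (A : set X) : Prop :=
  [/\ A !=set0, compact A & connected A].

Record hyperspace (R : realType) (X : metricType R) : Type := Hyperspace {
  carrier :> set X;
  carrierP : subcontinuum carrier
}.

Section hausdorff_metric.
Context {R : realType} {X : metricType R}.
Implicit Types (A B C : set X) (e : R).

Definition neighborhood e A : set X := \bigcup_(a in A) ball a e.

Definition hausdorff_radii A B : set R :=
  [set e | [/\ 0 < e, A `<=` neighborhood e B & B `<=` neighborhood e A]].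

Definition hausdorff_dist A B : R := inf (hausdorff_radii A B).

Lemma hausdorff_radii_lb A B : lbound (hausdorff_radii A B) 0.
Proof. by move=> e [/ltW]. Qed.

Lemma hausdorff_radii_sym A B : hausdorff_radii A B = hausdorff_radii B A.
Proof. by apply/seteqP; split => e [? ? ?]; split. Qed.

Lemma neighborhood_le e e' A :
  e <= e' -> neighborhood e A `<=` neighborhood e' A.
Proof. by move=> ee' x [a Aa aex]; exists a => //; exact: le_ball aex. Qed.

Lemma neighborhoodD e e' A B C :
  A `<=` neighborhood e B -> B `<=` neighborhood e' C ->
  A `<=` neighborhood (e + e') C.
Proof.
move=> AB BC x /AB[b /BC[c Cc cb] bx]; exists c => //.
by rewrite addrC; exact: ball_triangle cb bx.
Qed.

Lemma compact_sub_neighborhood A B : compact A -> B !=set0 ->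
  exists2 e, 0 < e & A `<=` neighborhood e B.
Proof.
move=> cA [b Bb].
have cd : continuous (mdist b : X -> R).
  move=> x; apply/cvgrPdist_lt => e e0.
  near=> y.
  have : ball x e y by near: y; exact: nbhsx_ballx.
  rewrite ballEmdist /= => xye.
  apply: le_lt_trans xye; rewrite ler_norml; apply/andP; split.
    by rewrite lerNl opprB lerBlDr addrC; exact: metric_triangle.
  by rewrite lerBlDr addrC [mdist x y]metric_sym; exact: metric_triangle.
have /compact_bounded[M [_ MA]] : compact (mdist b @` A).
  by apply: continuous_compact => //; exact: continuous_subspaceT.
exists (`|M| + 2); first by rewrite ltr_wpDl.
move=> x Ax; exists b => //; rewrite ballEmdist /=.
have /= : `|mdist b x| <= `|M| + 1.
  apply: MA; last by exists x.
  by rewrite (le_lt_trans (ler_norm M))// ltrDl.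
move=> /(le_trans (ler_norm _))/le_lt_trans; apply.
by rewrite ltrD2l ltr1n.
Unshelve. all: by end_near. Qed.

Lemma hausdorff_radii_neq0 (A B : hyperspace X) : hausdorff_radii A B !=set0.
Proof.
have [A0 cA _] := carrierP A; have [B0 cB _] := carrierP B.
have [e e0 AB] := compact_sub_neighborhood cA B0.
have [e' e'0 BA] := compact_sub_neighborhood cB A0.
exists (e + e'); split; first by rewrite addr_gt0.
- by apply: subset_trans AB _; apply: neighborhood_le; rewrite lerDl ltW.
- by apply: subset_trans BA _; apply: neighborhood_le; rewrite lerDr ltW.
Qed.

Lemma hausdorff_dist_lt (A B : hyperspace X) e :
  hausdorff_dist A B < e -> hausdorff_radii A B e.
Proof.
move=> /(inf_lt (hausdorff_radii_neq0 A B))[r [r0 AB BA] re].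
split; first exact: lt_trans re.
- by apply: subset_trans AB _; exact/neighborhood_le/ltW.
- by apply: subset_trans BA _; exact/neighborhood_le/ltW.
Qed.

Lemma hausdorff_dist_le A B e : hausdorff_radii A B e -> hausdorff_dist A B <= e.
Proof. by move=> ABe; apply: ge_inf => //; exists 0; exact: hausdorff_radii_lb. Qed.

Lemma hausdorff_distxx (A : hyperspace X) : hausdorff_dist A A = 0.
Proof.
apply/eqP; rewrite eq_le; apply/andP; split; last first.
  by apply: lb_le_inf; [exact: hausdorff_radii_neq0|exact: hausdorff_radii_lb].
apply/ler_addgt0Pl => e e0; rewrite addr0; apply: hausdorff_dist_le.
by split => // x Ax; exists x => //; exact: ballxx.
Qed.

Lemma hausdorff_dist_sym A B : hausdorff_dist A B = hausdorff_dist B A.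
Proof. by rewrite /hausdorff_dist hausdorff_radii_sym. Qed.

Lemma hausdorff_dist_triangle (B A C : hyperspace X) :
  hausdorff_dist A C <= hausdorff_dist A B + hausdorff_dist B C.
Proof.
apply/ler_addgt0Pl => e e0.
have e20 : 0 < e / 2 by rewrite divr_gt0.
have /hausdorff_dist_lt[r0 AB BA] : hausdorff_dist A B < hausdorff_dist A B + e / 2.
  by rewrite ltrDl.
have /hausdorff_dist_lt[s0 BC CB] : hausdorff_dist B C < hausdorff_dist B C + e / 2.
  by rewrite ltrDl.
rewrite [e in leRHS]splitr addrC addrACA; apply: hausdorff_dist_le; split.
- by rewrite addr_gt0.
- exact: neighborhoodD AB BC.
- by rewrite addrC; exact: neighborhoodD CB BA.
Qed.

Lemma hausdorff_dist0_sub (A B : hyperspace X) :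
  hausdorff_dist A B = 0 -> A `<=` B.
Proof.
move=> AB0 x Ax.
have [_ cB _] := carrierP B.
have /closure_id -> := compact_closed (@metric_hausdorff R X) cB.
move=> V /nbhs_ballP[e /= e0 eV].
have [_ /(_ _ Ax)[b Bb /ball_sym bx] _] : hausdorff_radii A B e.
  by apply: hausdorff_dist_lt; rewrite AB0.
by exists b; split => //; exact: eV.
Qed.

Lemma hyperspace_eq (A B : hyperspace X) : carrier A = carrier B -> A = B.
Proof.
case: A B => [A pA] [B pB] /= AB; case: _ / AB pB => pB.
by rewrite (Prop_irrelevance pA pB).
Qed.

Lemma hausdorff_dist_positivity (A B : hyperspace X) :
  hausdorff_dist A B = 0 -> A = B.
Proof.
move=> AB0; apply/hyperspace_eq/seteqP; split.
  exact: hausdorff_dist0_sub.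
by apply: hausdorff_dist0_sub; rewrite hausdorff_dist_sym.
Qed.

End hausdorff_metric.

HB.instance Definition _ (R : realType) (X : metricType R) :=
  gen_eqMixin (hyperspace X).
HB.instance Definition _ (R : realType) (X : metricType R) :=
  gen_choiceMixin (hyperspace X).
HB.instance Definition _ (R : realType) (X : metricType R) :=
  @isMetric.Build R (hyperspace X)
    (fun A B : hyperspace X => hausdorff_dist A B)
    (@hausdorff_distxx R X) (@hausdorff_dist_positivity R X)
    (fun A B => hausdorff_dist_sym A B) (@hausdorff_dist_triangle R X).

Lemma subcontinuum1 (X : topologicalType) (x : X) : subcontinuum [set x].
Proof. by split; [exists x|exact: compact_set1|exact: connected1]. Qed.

Definition singleton (R : realType) (X : metricType R) (x : X) : hyperspace X :=
  Hyperspace (subcontinuum1 x).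

Lemma subcontinuumT (R : realType) (X : topologicalType) :
  continuum R X -> subcontinuum [set: X].
Proof. by case. Qed.

Definition whole (R : realType) (X : metricType R) (cX : continuum R X) :
    hyperspace X :=
  Hyperspace (subcontinuumT cX).

Record whitney_map (R : realType) (X : metricType R) (cX : continuum R X)
    (mu : hyperspace X -> R) : Prop := {
  whitney_continuous : continuous mu;
  whitney_range : forall A : hyperspace X, 0 <= mu A <= mu (whole cX);
  whitney_singleton : forall x : X, mu (singleton x) = 0;
  whitney_strict : forall A B : hyperspace X, A `<` B -> mu A < mu B
}.

(* The subset of [hyperspace X] is coerced to the type [set_type _], which
   carries the subspace topology. *)
Definition whitney_level (R : realType) (X : metricType R)
    (mu : hyperspace X -> R) (t : R) : topologicalType :=
  (mu @^-1` [set t] : set (hyperspace X)).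

Definition whitney_property (R : realType) (P : topologicalType -> Prop) : Prop :=
  forall (X : metricType R) (cX : continuum R X), P X ->
  forall mu : hyperspace X -> R, whitney_map cX mu ->
  forall t : R, 0 <= t < mu (whole cX) -> P (whitney_level mu t).

(* Main.v *)
(** Sets of a Whitney level which lie in a subcontinuum [Y] form a connected
    set: two members meeting at [x] are joined inside the level by letting a
    continuum grow from [x] to the one while another shrinks in the other.

    Given [A] in the level of [t], colocal connectedness and [t < mu X] yield a
    finite cover of [A] by small open sets [U b], [b] in [A], with connected
    complements, such that whenever [U b] and [U c] meet, some member of the
    level avoids both.  The members meeting every [U b] form a small
    neighborhood of [A]: a member of the level that nearly contains [A] is close
    to [A], because [mu] is strictly monotone and the hyperspace is compact.
    The complement of this neighborhood is the union of the connected sets [K b]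
    of members contained in [~` U b]; since [K b] and [K c] meet whenever [U b]
    and [U c] do, and [A] is connected, this union is connected. *)

Require Import Defs.
From mathcomp Require Import all_boot all_order all_algebra.
From mathcomp Require Import all_classical all_reals all_analysis.
From mathcomp Require Import lra.

Set Implicit Arguments.
Unset Strict Implicit.
Unset Printing Implicit Defensive.

Import Order.TTheory GRing.Theory Num.Theory.
Import numFieldNormedType.Exports.

Local Open Scope classical_set_scope.
Local Open Scope ring_scope.

Lemma at_right0_ex (R : realType) (P : R -> Prop) :
  (\forall e \near 0^'+, P e) -> exists2 e, 0 < e & P e.
Proof.
move=> nearP.
have [e [e0 Pe]] : exists e, 0 < e /\ P e; last by exists e.
apply: (@filter_ex _ (0 : R)^'+); near=> e; split; near: e => //.
exact: nbhs_right_gt.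
Unshelve. all: by end_near. Qed.

(** * Connectedness by small steps in metric spaces *)

Section chained.
Context {R : realType} {T : metricType R}.
Implicit Types (A B K L P U : set T) (e r : R).

(** Encodes, without finite sequences, that any two points of [K] are joined by a chain in [K] with
    steps shorter than [e]. *)
Definition chained e K := forall P, P `<=` K -> P !=set0 ->
  (forall x y, P x -> K y -> ball x e y -> P y) -> K `<=` P.

Lemma neighborhood_sub_self e A : 0 < e -> A `<=` neighborhood e A.
Proof. by move=> e0 x Ax; exists x => //; exact: ballxx. Qed.

Lemma compact_neighborhood_sub K U : compact K -> open U -> K `<=` U ->
  \forall e \near 0^'+, neighborhood e K `<=` U.
Proof.
move=> /compact_near_coveringP cK oU KU.
have : \forall e \near 0^'+, K `<=` (fun x => ball x e `<=` U).
  apply: cK => x /KU Ox.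
  have /nbhs_ballP[r /= r0 rO] := open_nbhs_nbhs (conj oU Ox).
  near=> y e => z /= yz; apply: rO.
  rewrite (splitr r); apply: (@ball_triangle _ _ y).
    by near: y; apply: near_ball; rewrite divr_gt0.
  by apply: le_ball yz; near: e; apply: nbhs_right_le; rewrite divr_gt0.
by apply: filterS => e KeO z [x /KeO]; exact.
Unshelve. all: by end_near. Qed.

Lemma chainedW e e' K : e <= e' -> chained e K -> chained e' K.
Proof.
move=> ee' cK P PK P0 Pe; apply: cK => // x y Px Ky xy.
by apply: (Pe x) => //; exact: le_ball xy.
Qed.

(** The balls of radius [e] about points of [P] and about points of [K] outside [P] show that [P] is
    open and closed in [K]. *)
Lemma connected_chained e K : 0 < e -> connected K -> chained e K.
Proof.
move=> e0 cK P PK P0 Pe; suff <- : P = K by [].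
have in_int x : (ball x e)° x by exact: nbhsx_ballx.
apply: cK => //.
- exists (\bigcup_(x in P) (ball x e)°).
    by apply: bigcup_open => x _; exact: open_interior.
  apply/seteqP; split => [x Px|y [Ky [x Px /interior_subset]]]; last exact: Pe.
  by split; [exact: PK|exists x].
- exists (~` \bigcup_(x in K `\` P) (ball x e)°).
    by apply: open_closedC; apply: bigcup_open => x _; exact: open_interior.
  apply/seteqP; split => [y Py|y [Ky yP]].
    split; first exact: PK.
    by move=> [x [Kx Px] /interior_subset/ball_sym yx]; apply: Px; exact: Pe yx.
  by apply: contrapT => Py; apply: yP; exists y.
Qed.

(** A relatively clopen [B] is compact inside the open [U] that cuts it out, so some neighborhood of
    radius [e] stays in [U] and steps shorter than [e] cannot leave [B]. *)
Lemma chained_connected K :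
  compact K -> (forall e, 0 < e -> chained e K) -> connected K.
Proof.
move=> cK chK B B0 [U oU BU] [C cC BC].
have [BsU BK] : B `<=` U /\ B `<=` K.
  by rewrite BU; split=> [x [_ Ux]|x [Kx _]]; [exact: Ux|exact: Kx].
have cB : compact B by rewrite BC; exact: compact_closedI.
have [e e0 eU] := at_right0_ex (compact_neighborhood_sub cB oU BsU).
apply/seteqP; split => //; apply: (chK e) => // x y Bx Ky xy.
by rewrite BU; split => //; apply: eU; exists x.
Qed.

(** A step of the approximating [C] shorter than [r], with both ends moved by less than [r] into
    [L], becomes a step shorter than [3r]; [r = e / 4] leaves room. *)
Lemma chained_limit L :
  (forall e, 0 < e -> exists C, [/\ chained e C, C `<=` neighborhood e L &
                                  L `<=` neighborhood e C]) ->
  forall e, 0 < e -> chained e L.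
Proof.
move=> appr e e0 P PL [p Pp] Pe; pose r := e / 2 / 2.
have r0 : 0 < r by rewrite !divr_gt0.
have er : e = r + r + (r + r) by rewrite /r -!splitr.
have {}Pe x y : P x -> L y -> ball x (r + r + r) y -> P y.
  move=> Px Ly xy; apply: (Pe x) => //; apply: le_ball xy.
  by rewrite er addrA lerDl ltW.
have [C [chC CL LC]] := appr _ r0.
have CP : C `<=` neighborhood r P.
  pose Q := C `&` neighborhood r P.
  suff : C `<=` Q by move=> CQ x /CQ[].
  apply: chC; first by move=> x [].
    have [c Cc cp] := LC _ (PL _ Pp).
    by exists c; split => //; exists p => //; exact: ball_sym.
  move=> x y [Cx [q Pq qx]] Cy xy; split => //.
  have [l Ll ly] := CL _ Cy; exists l => //.
  apply: (Pe q) => //.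
  by apply: ball_triangle (ball_sym ly); exact: ball_triangle xy.
move=> l Ll; have [c Cc cl] := LC _ Ll; have [q Pq qc] := CP _ Cc.
apply: (Pe q) => //; apply: le_ball (ball_triangle qc cl).
by rewrite lerDl ltW.
Qed.

End chained.

(** * Chain hulls and boundary bumping *)

Section growth.
Context {R : realType} {T : metricType R}.
Implicit Types (A B C K P : set T) (e r : R).

Lemma closure_neighborhood_sub e r A : 0 < r ->
  closure (neighborhood e A) `<=` neighborhood (e + r) A.
Proof.
move=> r0 x /(_ _ (nbhsx_ballx x r r0))[y [[a Aa ay] /ball_sym yx]].
by exists a => //; exact: ball_triangle yx.
Qed.

Lemma metric_compact_closed A : compact A -> closed A.
Proof. by apply: compact_closed; exact: metric_hausdorff. Qed.

(** The points reached from [A] by [e]-chains in [K], obtained by intersecting all step-closed sets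
    that contain [A]. *)
Definition chain_hull K A e : set T := [set x | K x /\
  forall P, A `<=` P -> (forall y z, P y -> K z -> ball y e z -> P z) -> P x].

Lemma sub_chain_hull K A e : A `<=` K -> A `<=` chain_hull K A e.
Proof. by move=> AK x Ax; split=> [|P AP _]; [exact: AK|exact: AP]. Qed.

Lemma chain_hull_step K A e x y :
  chain_hull K A e x -> K y -> ball x e y -> chain_hull K A e y.
Proof.
by move=> [Kx Hx] Ky xy; split=> // P AP Pe; apply: (Pe x) => //; exact: Hx.
Qed.

Lemma chain_hull_le K A e e' :
  e <= e' -> chain_hull K A e `<=` chain_hull K A e'.
Proof.
move=> ee' x [Kx Hx]; split=> // P AP Pe; apply: Hx => // y z Py Kz yz.
by apply: (Pe y) => //; exact: le_ball yz.
Qed.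

(** If [P] meets [A], it absorbs the connected [A] and then the hull by minimality. If not, the hull
    without [P] contains [A] and is step-closed by symmetry of the distance, so it is the whole
    hull, against [P] being nonempty. *)
Lemma chain_hull_chained K A e : 0 < e -> connected A -> A `<=` K ->
  chained e (chain_hull K A e).
Proof.
move=> e0 cA AK P PH [p Pp] Pe x [_ Hx].
have [[a [Aa Pa]]|PA] := pselect (A `&` P !=set0).
  have AP : A `<=` P.
    suff : A `<=` A `&` P by move=> + y Ay => /(_ _ Ay)[].
    apply: (connected_chained e0) => //; [by exists a|].
    move=> y z [Ay Py] Az yz; split=> //.
    by apply: (Pe y) => //; exact: sub_chain_hull.
  apply: Hx => // y z Py Kz yz; apply: (Pe y) => //.
  exact: chain_hull_step (PH _ Py) Kz yz.
have [_ /(_ (chain_hull K A e `\` P))] := PH _ Pp; case=> //.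
  by move=> a Aa; split; [exact: sub_chain_hull|move=> Pa; apply: PA; exists a].
move=> y z [Hy nPy] Kz yz; split; first exact: chain_hull_step yz.
by move=> Pz; apply: nPy; apply: (Pe z) => //; exact: ball_sym.
Qed.

Lemma chain_hull_closed K A e : 0 < e -> closed K -> closed (chain_hull K A e).
Proof.
move=> e0 cK x Hx; have Kx : K x.
  by apply: cK => V /Hx[y [[Ky _] Vy]]; exists y.
have [y [Hy /ball_sym yx]] := Hx _ (nbhsx_ballx x e e0).
exact: chain_hull_step yx.
Qed.

(* In a compact set the component and the quasicomponent of [A] agree; here the
   quasicomponent is the intersection of the chain hulls. *)
Lemma bigcap_chain_hull_limit K A r : compact K -> 0 < r ->
  \forall e \near 0^'+, chain_hull K A e `<=`
    neighborhood r (\bigcap_(e in [set e | 0 < e]) chain_hull K A e).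
Proof.
move=> /compact_near_coveringP cK r0; set C := \bigcap_(_ in _) _.
have : \forall e \near 0^'+, K `<=`
    (fun x => chain_hull K A e x -> neighborhood r C x).
  apply: cK => x Kx; have [Cx|/existsNP[s /not_implyP[/= s0 Hsx]]] := pselect (C x).
    near=> y e => _; exists x => //; near: y; exact: near_ball.
  near=> y e => Hey; exfalso; apply: Hsx.
  have es : e <= s by near: e; exact: nbhs_right_le.
  apply: chain_hull_step (chain_hull_le es Hey) Kx _.
  by apply: ball_sym; near: y; exact: near_ball.
by apply: filterS => e KH x Hx; apply: KH => //; case: Hx.
Unshelve. all: by end_near. Qed.

(** [C] is the intersection of the chain hulls of [A] in [K]. If it were [A], a fine chain hull
    would stay within [s / 2] of [A], so short steps in [B] could not leave [K]; the hull would be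
    all of [B], and [B] would lie in every neighborhood of [A]. *)
Lemma boundary_bumping A B r : subcontinuum A -> subcontinuum B ->
  A `<=` B -> ~ B `<=` A -> 0 < r ->
  exists C, [/\ subcontinuum C, A `<=` C, C `<=` B, C `<=` neighborhood r A &
                ~ C `<=` A].
Proof.
move=> [A0 cA ctA] [B0 cB ctB] AB nBA r0.
pose s := r / 2; have s0 : 0 < s by rewrite divr_gt0.
pose K := B `&` closure (neighborhood s A).
have cK : compact K by apply: compact_closedI => //; exact: closed_closure.
have AK : A `<=` K.
  move=> x Ax; split; first exact: AB.
  by apply: subset_closure; exact: neighborhood_sub_self.
pose C := \bigcap_(e in [set e | 0 < e]) chain_hull K A e.
have CK : C `<=` K by move=> x /(_ 1 ltr01)[].
have AC : A `<=` C by move=> x Ax e e0; exact: sub_chain_hull.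
have clC : closed C.
  apply: closed_bigI => e e0; apply: chain_hull_closed => //.
  exact: metric_compact_closed.
have cC : compact C by apply: subclosed_compact CK.
exists C; split => //.
- split => //; first by case: A0 => a /AC; exists a.
  apply: chained_connected => //; apply: chained_limit => e e0.
  have [f f0 [fC fe]] := at_right0_ex
    (filterI (bigcap_chain_hull_limit A cK e0) (nbhs_right_le e0)).
  exists (chain_hull K A f); split => //.
    by apply: chainedW fe _; exact: chain_hull_chained.
  by move=> x Cx; exists x; [exact: Cx|exact: ballxx].
- by move=> x /CK[].
- move=> x /CK[_ /(closure_neighborhood_sub s0)].
  by rewrite -splitr.
- move=> CA; apply: nBA => b Bb; apply: (metric_compact_closed cA).
  move=> V /nbhs_ballP[e /= e0 eV].
  have s20 : 0 < s / 2 by rewrite divr_gt0.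
  have [f f0 [[fe fs'] fs]] := at_right0_ex (filterI
    (filterI (bigcap_chain_hull_limit A cK e0)
             (bigcap_chain_hull_limit A cK s20)) (nbhs_right_le s20)).
  have /fe[a Ca /ball_sym ab] : chain_hull K A f b.
    apply: (connected_chained f0 ctB) Bb.
    + by move=> x [[]].
    + by case: A0 => a Aa; exists a; exact: sub_chain_hull.
    + move=> x y Hx By xy; apply: chain_hull_step (Hx) _ (xy); split => //.
      apply: subset_closure; have [a Ca ax] := fs' _ Hx.
      exists a; first exact: CA.
      rewrite (splitr s); apply: ball_triangle ax _; exact: le_ball xy.
  by exists a; split; [exact: CA|exact: eV].
Qed.

End growth.

(** * Compactness and closed subsets of the hyperspace *)

Section hyperspace_topology.
Context {R : realType} {X : metricType R}.
Implicit Types (A B C : hyperspace X) (e r : R).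

Lemma ball_hyperspace_sub A B e : ball A e B ->
  A `<=` neighborhood e B /\ B `<=` neighborhood e A.
Proof. by rewrite ballEmdist /= => /hausdorff_dist_lt[]. Qed.

Lemma sub_ball_hyperspace A B e r : 0 < r -> r < e ->
  A `<=` neighborhood r B -> B `<=` neighborhood r A -> ball A e B.
Proof.
move=> r0 re AB BA; rewrite ballEmdist /=.
by apply: le_lt_trans re; exact: hausdorff_dist_le.
Qed.

Lemma hyperspace_closed A : closed (A : set X).
Proof. by case: (carrierP A) => _ cA _; exact: metric_compact_closed. Qed.

(** An ultrafilter [F] converges to the set [L] of points all of whose balls are met by [F]-almost
    all continua; [L] is connected as a Hausdorff limit of continua. *)
Lemma hyperspace_compact : compact [set: X] -> compact [set: hyperspace X].
Proof.
move=> cX; rewrite compact_ultra => F FU _ /=.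
have /compact_near_coveringP cXn := cX.
pose L : set X := [set x | forall e, 0 < e ->
  F [set A : hyperspace X | exists2 y, carrier A y & ball x e y]].
have clL : closed L.
  move=> x Lx e e0.
  have e20 : 0 < e / 2 by rewrite divr_gt0.
  have [y [Ly xy]] := Lx _ (nbhsx_ballx x _ e20).
  apply: filterS (Ly _ e20) => A [z Az yz]; exists z => //.
  by rewrite (splitr e); exact: ball_triangle yz.
have cL : compact L by exact: subclosed_compact cX _.
have LF e : 0 < e -> F [set A : hyperspace X | L `<=` neighborhood e A].
  move=> e0; have /compact_near_coveringP := cL; apply => x Lx.
  have e20 : 0 < e / 2 by rewrite divr_gt0.
  near=> y A.
  have [z Az xz] : [set A : hyperspace X | exists2 y, carrier A y & ball x (e / 2) y] A.
    by near: A; exact: Lx.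
  exists z => //; rewrite (splitr e); apply: ball_triangle (ball_sym xz) _.
  by near: y; exact: near_ball.
have FL e : 0 < e -> F [set A : hyperspace X | (A : set X) `<=` neighborhood e L].
  move=> e0.
  have : \forall A \near F, [set: X] `<=` (fun x => carrier A x -> neighborhood e L x).
    apply: cXn => x _.
    have [Lx|/existsNP[r /not_implyP[r0 nLx]]] := pselect (L x).
      by near=> y A => _; exists x => //; near: y; exact: near_ball.
    (* Since [F] is an ultrafilter, a ball not met by [F]-almost all continua is missed by
       [F]-almost all. *)
    have [//|miss] := in_ultra_setVsetC
      [set A : hyperspace X | exists2 y, carrier A y & ball x r y] FU.
    near=> y A => Ay; exfalso.
    have : (~` [set A : hyperspace X | exists2 y, carrier A y & ball x r y]) A by near: A.
    by apply; exists y => //; near: y; exact: near_ball.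
  by apply: filterS => A AL x Ax; exact: AL.
have approx e : 0 < e -> exists A : hyperspace X,
    (A : set X) `<=` neighborhood e L /\ L `<=` neighborhood e A.
  by move=> e0; exact: filter_ex (filterI (FL e e0) (LF e e0)).
have [A [AL _]] := approx 1 ltr01.
have L0 : L !=set0 by case: (carrierP A) => -[a /AL[l Ll _]] _ _; exists l.
have ctL : connected L.
  apply: chained_connected => //; apply: chained_limit => e e0.
  have [B [BL LB]] := approx e e0; exists B; split => //.
  by apply: connected_chained => //; case: (carrierP B).
exists (Hyperspace (And3 L0 cL ctL)); split=> // V /nbhs_ballP[e /= e0 eV].
have e20 : 0 < e / 2 by rewrite divr_gt0.
apply: filterS (filterI (FL _ e20) (LF _ e20)) => B [BL LB]; apply: eV.
apply: (@sub_ball_hyperspace _ _ _ (e / 2)) => //.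
by rewrite ltr_pdivrMr// ltr_pMr// ltr1n.
Unshelve. all: by end_near. Qed.

Lemma closed_hyperspace_sub (Y : set X) :
  closed Y -> closed [set A : hyperspace X | (A : set X) `<=` Y].
Proof.
move=> cY A clA x Ax; apply: cY => V /nbhs_ballP[e /= e0 eV].
have [B [BY /ball_hyperspace_sub[/(_ _ Ax)[b Bb bx] _]]] :=
  clA _ (nbhsx_ballx A e e0).
by exists b; split; [exact: BY|apply: eV; exact: ball_sym].
Qed.

Lemma closed_hyperspace_mem (x : X) : closed [set A : hyperspace X | carrier A x].
Proof.
move=> A clA; apply: (hyperspace_closed (A := A)) => V /nbhs_ballP[e /= e0 eV].
have [B [Bx /ball_hyperspace_sub[_ /(_ _ Bx)[a Aa ax]]]] :=
  clA _ (nbhsx_ballx A e e0).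
by exists a; split => //; apply: eV; exact: ball_sym.
Qed.

End hyperspace_topology.

(** * Unions of intersecting subcontinua *)

Section union.
Context {R : realType} {X : metricType R}.
Implicit Types (A B C D : hyperspace X) (e r : R).

Lemma neighborhoodS e (A B : set X) :
  A `<=` B -> neighborhood e A `<=` neighborhood e B.
Proof. by move=> AB x [a /AB Ba ax]; exists a. Qed.

Lemma subcontinuumU (A B : set X) : subcontinuum A -> subcontinuum B ->
  A `&` B !=set0 -> subcontinuum (A `|` B).
Proof.
move=> [[a Aa] cA ctA] [_ cB ctB] AB; split; first by exists a; left.
- exact: compactU.
- exact: connectedU.
Qed.

(* Junk value [A] when [A] and [B] are disjoint. *)
Definition hyperspaceU A B : hyperspace X :=
  if pselect (A `&` B !=set0) is left AB
  then Hyperspace (subcontinuumU (carrierP A) (carrierP B) AB) else A.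

Lemma hyperspaceUE A B x : carrier A x -> carrier B x ->
  carrier (hyperspaceU A B) = carrier A `|` carrier B.
Proof.
by move=> Ax Bx; rewrite /hyperspaceU; case: pselect => // -[]; exists x.
Qed.

Lemma ball_hyperspaceU A A' B B' x e r : r < e ->
  carrier A x -> carrier B x -> carrier A' x -> carrier B' x ->
  ball A r A' -> ball B r B' -> ball (hyperspaceU A B) e (hyperspaceU A' B').
Proof.
move=> re Ax Bx A'x B'x AA' BB'; have [AA A'A] := ball_hyperspace_sub AA'.
have [BB B'B] := ball_hyperspace_sub BB'.
have r0 : 0 < r by move: AA'; rewrite ballEmdist /=; exact/le_lt_trans/mdist_ge0.
apply: sub_ball_hyperspace r0 re _ _;
  rewrite (hyperspaceUE Ax Bx) (hyperspaceUE A'x B'x) subUset; split.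
- by apply: subset_trans AA _; apply: neighborhoodS => ?; left.
- by apply: subset_trans BB _; apply: neighborhoodS => ?; right.
- by apply: subset_trans A'A _; apply: neighborhoodS => ?; left.
- by apply: subset_trans B'B _; apply: neighborhoodS => ?; right.
Qed.

End union.

(** * Whitney maps: uniform strictness and intermediate values *)

Section whitney.
Context {R : realType} {X : metricType R} {cX : continuum R X}.
Context {mu : hyperspace X -> R} (muW : whitney_map cX mu).
Implicit Types (A B C D E F : hyperspace X) (e r s t : R).

Let cpX : compact [set: X]. Proof. by case: cX. Qed.

Lemma whitney_eq A B : (A : set X) `<=` B -> mu B <= mu A -> A = B.
Proof.
move=> AB muBA; apply/hyperspace_eq/seteqP; split => //.
apply: contrapT => BA.
by have := whitney_strict muW (conj AB BA); rewrite ltNge muBA.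
Qed.

Lemma whitney_le A B : (A : set X) `<=` B -> mu A <= mu B.
Proof.
move=> AB; rewrite leNgt; apply/negP => lt.
by move: (lt); rewrite (whitney_eq AB (ltW lt)) ltxx.
Qed.

Lemma whitney_near A r : 0 < r ->
  exists2 e, 0 < e & forall B, ball A e B -> `|mu A - mu B| < r.
Proof.
move=> r0.
have /cvgrPdist_lt/(_ _ r0)/nbhs_ballP[e e0 eA] := whitney_continuous muW (x := A).
by exists e.
Qed.

(** Near a pair [(A, B)] with [A] not inside [B], the inclusion fails for small [d]; with [A] inside
    [B] and [mu A < mu B], the inequality fails; otherwise [A = B] and nearby pairs are close.
    Compactness of the space of pairs makes [d] uniform. *)
Lemma whitney_closer e : 0 < e -> exists2 d, 0 < d &
  forall A B, (A : set X) `<=` neighborhood d B -> mu B <= mu A -> ball A e B.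
Proof.
move=> e0.
have /compact_near_coveringP cpt :
    compact ([set: hyperspace X] `*` [set: hyperspace X]).
  by apply: compact_setX; exact: hyperspace_compact.
have : \forall d \near 0^'+, [set: hyperspace X] `*` [set: hyperspace X] `<=`
    (fun p => (p.1 : set X) `<=` neighborhood d p.2 -> mu p.2 <= mu p.1 ->
              ball p.1 e p.2).
  apply: cpt => -[A B] _ /=.
  have nearP r : 0 < r -> \forall p \near (A, B), ball A r p.1 /\ ball B r p.2.
    by move=> r0; exact: (nbhsx_ballx (A, B) r r0).
  have [AB|/existsNP[a /not_implyP[Aa Ba]]] := pselect ((A : set X) `<=` B).
    have [BA|AltB] := leP (mu B) (mu A).
      have e20 : 0 < e / 2 by rewrite divr_gt0.
      near=> p d => _ _.
      have [] : ball A (e / 2) p.1 /\ ball B (e / 2) p.2 by near: p; exact: nearP.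
      rewrite -(whitney_eq AB BA) => /ball_sym pA Ap.
      by rewrite (splitr e); exact: ball_triangle Ap.
    pose r := (mu B - mu A) / 2.
    have r0 : 0 < r by rewrite divr_gt0// subr_gt0.
    have [eA eA0 HA] := whitney_near A r0.
    have [eB eB0 HB] := whitney_near B r0.
    near=> p d => _ muBA; exfalso; move: muBA.
    have [pA _] : ball A eA p.1 /\ ball B eA p.2 by near: p; exact: nearP.
    have [_ pB] : ball A eB p.1 /\ ball B eB p.2 by near: p; exact: nearP.
    have := HA _ pA; rewrite distrC => /ltr_distlDr.
    have /ltr_distlDr := HB _ pB.
    rewrite /r; lra.
  (* The gap of at least [3r] between [a] and [B] pays for perturbing [A], perturbing [B], and the
     radius [d <= r]. *)
  have [r r0 rB] : exists2 r, 0 < r &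
      forall b, carrier B b -> ~ ball a (r + r + r) b.
    have /nbhs_ballP[r /= r0 rB] : nbhs a (~` (B : set X)).
      apply: open_nbhs_nbhs; split => //.
      by apply: closed_openC; exact: hyperspace_closed.
    exists (r / 3); first by rewrite divr_gt0.
    move=> b Bb; rewrite (_ : _ + _ = r); first by move/rB.
    lra.
  near=> p d => pd _; exfalso.
  have [] : ball A r p.1 /\ ball B r p.2 by near: p; exact: nearP.
  move=> /ball_hyperspace_sub[/(_ _ Aa)[a' pa' a'a] _].
  move=> /ball_hyperspace_sub[_].
  have [b' pb' b'a'] := pd _ pa' => /(_ _ pb')[b Bb bb'].
  have dr : d <= r by near: d; exact: nbhs_right_le.
  apply: (rB _ Bb); apply: ball_triangle (ball_sym bb').
  by apply: ball_triangle (ball_sym a'a) _; apply: ball_sym; exact: le_ball b'a'.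
move=> /at_right0_ex[d d0 dP].
by exists d => // A B; exact: (dP (A, B)).
Unshelve. all: by end_near. Qed.

(** Among the [C] whose union with [D] has value at most [s], one of maximal [mu] attains [s]:
    otherwise boundary bumping enlarges it inside [C1] by so little that the value stays below
    [s]. *)
Lemma whitney_fill (C1 D : hyperspace X) (x : X) s :
  carrier C1 x -> carrier D x -> mu D <= s <= mu (hyperspaceU C1 D) ->
  exists C : hyperspace X,
    [/\ carrier C x, (C : set X) `<=` C1 & mu (hyperspaceU C D) = s].
Proof.
move=> C1x Dx /andP[Ds sC1].
pose S := [set C : hyperspace X |
  [/\ carrier C x, (C : set X) `<=` C1 & mu (hyperspaceU C D) <= s]].
have clS : closed S.
  move=> C clC.
  have Cx : carrier C x.
    by apply: (@closed_hyperspace_mem _ _ x) => V /clC[E [[Ex _ _] VE]]; exists E.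
  split => //.
    apply: (@closed_hyperspace_sub _ _ (C1 : set X) (@hyperspace_closed _ _ _)).
    by move=> V /clC[E [[_ EC1 _] VE]]; exists E.
  rewrite leNgt; apply/negP => sC.
  have d0 : 0 < mu (hyperspaceU C D) - s by rewrite subr_gt0.
  have [e e0 He] := whitney_near (hyperspaceU C D) d0.
  have e20 : 0 < e / 2 by rewrite divr_gt0.
  have [E [[Ex _ Es] CE]] := clC _ (nbhsx_ballx C _ e20).
  have : ball (hyperspaceU C D) e (hyperspaceU E D).
    apply: (@ball_hyperspaceU _ _ _ _ _ _ x _ (e / 2)) => //; [lra|exact: ballxx].
  by move=> /He/ltr_distlDr; lra.
have cS : compact S by exact: subclosed_compact (hyperspace_compact cpX) _.
have S0 : S !=set0.
  exists (singleton x); split => //; first by move=> y ->.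
  apply: le_trans Ds; apply: whitney_le.
  by rewrite (@hyperspaceUE _ _ _ _ x)// subUset; split => // y ->.
have [C /set_mem[Cx CC1 Cs] maxC] := compact_EVT_max S0 cS
  (continuous_subspaceT (whitney_continuous muW)).
exists C; split => //; apply/eqP; rewrite eq_le Cs /= leNgt; apply/negP => ltCs.
have nC1C : ~ (C1 : set X) `<=` C.
  move=> /(conj CC1)/seteqP/hyperspace_eq CE; move: ltCs.
  by rewrite CE ltNge sC1.
have d0 : 0 < s - mu (hyperspaceU C D) by rewrite subr_gt0.
have [e e0 He] := whitney_near (hyperspaceU C D) d0.
have e40 : 0 < e / 2 / 2 by rewrite !divr_gt0.
have [C' [sC' CC' C'C1 C'e nC'C]] :=
  boundary_bumping (carrierP C) (carrierP C1) CC1 nC1C e40.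
pose HC' := Hyperspace sC'.
have HC'x : carrier HC' x by exact: CC'.
have : ball (hyperspaceU C D) e (hyperspaceU HC' D).
  apply: (@ball_hyperspaceU _ _ _ _ _ _ x _ (e / 2)) => //; [lra| |by apply: ballxx; lra].
  apply: (@sub_ball_hyperspace _ _ _ _ _ (e / 2 / 2)) => //; first lra.
  by apply: subset_trans CC' _; exact: neighborhood_sub_self.
move=> /He/ltr_distlCDr HC's.
have : HC' \in S by apply/mem_set; split => //; lra.
move=> /maxC; rewrite leNgt => /negP; apply.
by apply: (whitney_strict muW); split.
Qed.

End whitney.

(** * Connectedness of Whitney levels *)

Section whitney_level.
Context {R : realType} {X : metricType R} {cX : continuum R X}.
Context {mu : hyperspace X -> R} (muW : whitney_map cX mu).
Implicit Types (A B C D E F : hyperspace X) (e r s t : R).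

Let cpX : compact [set: X]. Proof. by case: cX. Qed.

Definition level_in (Y : set X) t : set (hyperspace X) :=
  [set A : hyperspace X | (A : set X) `<=` Y /\ mu A = t].

Lemma level_in_closed (Y : set X) t : closed Y -> closed (level_in Y t).
Proof.
move=> cY; apply: closedI; first exact: closed_hyperspace_sub.
exact: (continuous_closedP mu).1 (whitney_continuous muW) _ (@closed_eq _ t).
Qed.

Lemma level_in_compact (Y : set X) t : closed Y -> compact (level_in Y t).
Proof.
move=> cY; apply: subclosed_compact (hyperspace_compact cpX) _ => //.
exact: level_in_closed.
Qed.

Lemma whitney_intermediate (Y : hyperspace X) (x : X) t :
  carrier Y x -> 0 <= t <= mu Y -> exists2 A, level_in Y t A & carrier A x.
Proof.
move=> Yx /andP[t0 tY].
have UE C : carrier C x -> hyperspaceU C (singleton x) = C.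
  move=> Cx; apply: hyperspace_eq; rewrite (@hyperspaceUE _ _ _ _ x)//.
  by apply/setUidPl => y ->.
have [|C [Cx CY]] := whitney_fill muW (D := singleton x) (s := t) Yx erefl.
  by rewrite (whitney_singleton muW) UE// t0.
by rewrite UE// => Ct; exists C.
Qed.

(* [A] is transformed into [B] through continua [C `|` D] of the level, where
   [D] grows from [x] to [B] while [C] shrinks inside [A]. *)
Lemma level_in_meet (Y : hyperspace X) t e (P : set (hyperspace X)) A B (x : X) :
  0 < e -> P `<=` level_in Y t ->
  (forall E F, P E -> level_in Y t F -> ball E e F -> P F) ->
  P A -> level_in Y t B -> carrier A x -> carrier B x -> P B.
Proof.
move=> e0 PY Pe PA [BY Bt] Ax Bx; have [AY At] := PY _ PA.
have hcX := hyperspace_compact cpX.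
have clP : closed P.
  move=> E clE; have [F [PF EF]] := clE _ (nbhsx_ballx E e e0).
  apply: (Pe F) => //; last exact: ball_sym.
  by apply: (level_in_closed (@hyperspace_closed _ _ Y)); exact: closureS clE.
(* The stages whose union is still in [P]; they form a compact set, so [mu] of the growing component
   attains a maximum. *)
pose S := [set p : hyperspace X * hyperspace X |
  [/\ carrier p.1 x, carrier p.2 x, (p.1 : set X) `<=` A, (p.2 : set X) `<=` B &
      P (hyperspaceU p.1 p.2)]].
have clS : closed S.
  move=> [C D] clCD.
  have near r : 0 < r -> exists C' D', [/\ S (C', D'), ball C r C' & ball D r D'].
    move=> r0; have [[C' D'] [SCD [CC' DD']]] := clCD _ (nbhsx_ballx (C, D) r r0).
    by exists C', D'.
  have Cx : carrier C x.
    apply: (@closed_hyperspace_mem _ _ x) => V /nbhs_ballP[r r0 rV].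
    by have [C' [D' [[? _ _ _ _] /rV ? _]]] := near _ r0; exists C'.
  have Dx : carrier D x.
    apply: (@closed_hyperspace_mem _ _ x) => V /nbhs_ballP[r r0 rV].
    by have [C' [D' [[_ ? _ _ _] _ /rV ?]]] := near _ r0; exists D'.
  split => //=.
  - apply: (@closed_hyperspace_sub _ _ (A : set X) (@hyperspace_closed _ _ _)).
    move=> V /nbhs_ballP[r r0 rV].
    by have [C' [D' [[_ _ ? _ _] /rV ? _]]] := near _ r0; exists C'.
  - apply: (@closed_hyperspace_sub _ _ (B : set X) (@hyperspace_closed _ _ _)).
    move=> V /nbhs_ballP[r r0 rV].
    by have [C' [D' [[_ _ _ ? _] _ /rV ?]]] := near _ r0; exists D'.
  - apply: clP => V /nbhs_ballP[r /= r0 rV].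
    have r20 : 0 < r / 2 by rewrite divr_gt0.
    have [C' [D' [[/= C'x D'x _ _ PCD] CC' DD']]] := near _ r20.
    exists (hyperspaceU C' D'); split => //; apply: rV.
    by apply: (@ball_hyperspaceU _ _ _ _ _ _ x _ (r / 2)) => //; lra.
have cS : compact S.
  by apply: subclosed_compact clS (compact_setX hcX hcX) _ => -[].
have S0 : S !=set0.
  exists (A, singleton x); split => //=; first by move=> y ->.
  rewrite (_ : hyperspaceU _ _ = A)//; apply: hyperspace_eq.
  by rewrite (@hyperspaceUE _ _ _ _ x)//; apply/setUidPl => y ->.
have cmu2 : {within S, continuous (mu \o snd)}.
  apply: continuous_subspaceT => p; apply: continuous_comp; first exact: cvg_snd.
  exact: (whitney_continuous muW).
have [[C D] /set_mem[/= Cx Dx CA DB PCD] maxD] := compact_EVT_max S0 cS cmu2.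
have [CDY CDt] := PY _ PCD.
have [BD|nBD] := pselect ((B : set X) `<=` D).
  suff <- : hyperspaceU C D = B by [].
  apply/esym/(whitney_eq muW); last by rewrite CDt Bt.
  by rewrite (hyperspaceUE Cx Dx) => y By; right; exact: BD.
(* If [D] grows by less than [d] and [C] shrinks to restore the value [t], the new union lies in the
   [d]-neighborhood of the old one with equal [mu]. It is then [e]-close to it and stays in [P],
   against maximality. *)
have [d d0 close] := whitney_closer muW e0.
have [D' [sD' DD' D'B D'd nD'D]] :=
  boundary_bumping (carrierP D) (carrierP B) DB nBD d0.
pose HD' := Hyperspace sD'.
have HD'x : carrier HD' x by exact: DD'.
have tCD' : mu HD' <= t <= mu (hyperspaceU C HD').
  rewrite -{1}Bt -CDt !(whitney_le muW)//.
  by rewrite (hyperspaceUE Cx Dx) (hyperspaceUE Cx HD'x); exact: setUS.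
have [C' [C'x C'C C't]] := whitney_fill muW Cx HD'x tCD'.
exfalso; have : (C', HD') \in S.
  apply/mem_set; split => //=; first exact: subset_trans CA.
  apply: (Pe (hyperspaceU C D)) => //.
    split => //; rewrite (hyperspaceUE C'x HD'x) subUset; split.
      by apply: subset_trans C'C _; exact: subset_trans AY.
    exact: subset_trans BY.
  apply/ball_sym/close; last by rewrite CDt C't.
  rewrite (hyperspaceUE C'x HD'x) (hyperspaceUE Cx Dx) subUset; split.
    by move=> y /C'C Cy; apply: neighborhood_sub_self => //; left.
  by apply: subset_trans D'd _; apply: neighborhoodS => ?; right.
move=> /maxD /=; rewrite leNgt => /negP; apply.
by apply: (whitney_strict muW); split.
Qed.

(** Each member misses a ball about a point outside the union, and nearby members miss the ball of
    half the radius; compactness of [P] gives one radius for all. *)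
Lemma closed_bigcup_hyperspace (P : set (hyperspace X)) :
  compact P -> closed (\bigcup_(A in P) (A : set X)).
Proof.
move=> /compact_near_coveringP cP x clx; apply: contrapT => nx.
have : \forall d \near 0^'+, P `<=` (fun A => ~ exists2 y, carrier A y & ball x d y).
  apply: cP => A PA.
  have /nbhs_ballP[r /= r0 rA] : nbhs x (~` (A : set X)).
    apply: open_nbhs_nbhs; split; first exact/closed_openC/hyperspace_closed.
    by move=> Ax; apply: nx; exists A.
  have r20 : 0 < r / 2 by rewrite divr_gt0.
  near=> B d => -[y By xy].
  have /ball_hyperspace_sub[_ /(_ _ By)[a Aa ay]] : ball A (r / 2) B.
    by near: B; exact: near_ball.
  have dr : d <= r / 2 by near: d; exact: nbhs_right_le.
  apply: (rA a) => //; rewrite (splitr r).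
  by apply: ball_triangle (ball_sym ay); exact: le_ball xy.
move=> /at_right0_ex[d d0 dP].
have [y [[A PA Ay] xy]] := clx _ (nbhsx_ballx x d d0).
by apply: (dP A PA); exists y.
Unshelve. all: by end_near. Qed.

(** If a step-closed [P] left a nonempty remainder [Q], their members would have closed unions
    covering the connected [Y], hence sharing a point [x]; [level_in_meet] at [x] then puts a member
    of [Q] into [P]. *)
Lemma level_in_connected (Y : hyperspace X) t : connected (level_in Y t).
Proof.
have clY := @hyperspace_closed _ _ Y.
apply: chained_connected; first exact: level_in_compact.
move=> e e0 P PY [A0 PA0] Pe B0 YB0; apply: contrapT => nPB0.
have [A0Y A0t] := PY _ PA0.
have t0Y : 0 <= t <= mu Y.
  by rewrite -A0t (whitney_le muW)// andbT; case/andP: (whitney_range muW A0).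
pose Q := level_in Y t `\` P.
have Qe E F : Q E -> level_in Y t F -> ball E e F -> Q F.
  move=> [YE nPE] YF EF; split => // PF; apply: nPE.
  by apply: (Pe F) => //; exact: ball_sym.
have compact_step (S : set (hyperspace X)) : S `<=` level_in Y t ->
    (forall E F, S E -> level_in Y t F -> ball E e F -> S F) -> compact S.
  move=> SY Se; apply: subclosed_compact (hyperspace_compact cpX) _ => //.
  move=> E clE; have [F [SF EF]] := clE _ (nbhsx_ballx E e e0).
  apply: (Se F) => //; last exact: ball_sym.
  by apply: (level_in_closed clY); exact: closureS clE.
have clUP := closed_bigcup_hyperspace (compact_step P PY Pe).
have clUQ := closed_bigcup_hyperspace (compact_step Q (@subDsetl _ _ _) Qe).
have [disj|/existsNP[x /not_implyP[]]] := pselect (forall x,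
    (\bigcup_(A in P) (A : set X)) x -> (\bigcup_(A in Q) (A : set X)) x -> False).
  have [_ _ ctY] := carrierP Y.
  have cover y : carrier Y y ->
      (\bigcup_(A in P) (A : set X)) y \/ (\bigcup_(A in Q) (A : set X)) y.
    move=> Yy; have [A YA Ay] := whitney_intermediate Yy t0Y.
    have [PA|nPA] := pselect (P A); first by left; exists A.
    by right; exists A.
  have YP : carrier Y `&` \bigcup_(A in P) (A : set X) = carrier Y.
    apply: ctY.
    - have [[a A0a] _ _] := carrierP A0.
      by exists a; split; [exact: A0Y|exists A0].
    - exists (~` \bigcup_(A in Q) (A : set X)); first exact: closed_openC.
      apply/seteqP; split=> y [Yy].
        by move=> Py; split => // Qy; exact: (disj y).
      by move=> nQy; split => //; case: (cover y Yy).
    - by exists (\bigcup_(A in P) (A : set X)).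
  have [[b B0b] _ _] := carrierP B0.
  apply: (disj b); last by exists B0.
  by move: (YB0.1 _ B0b); rewrite -YP => -[].
move=> [A PA Ax] /contrapT[B [YB nPB] Bx]; apply: nPB.
exact: (level_in_meet e0 PY Pe PA YB Ax Bx).
Qed.

End whitney_level.

Arguments level_in {R X} mu Y t _.
Arguments level_in_connected {R X cX mu} muW Y t.

(** * Nerves of covers, subcovers and subspaces *)

Section general_topology.

(* The union of the sets [K i] is connected because the nerve of the cover of
   the connected set [A] by the sets [U i] is a connected graph. *)
Lemma nerve_connected (S T : topologicalType) (I : Type) (D : set I)
    (A : set S) (U : I -> set S) (K : I -> set T) :
  connected A -> (forall i, D i -> open (U i)) -> A `<=` \bigcup_(i in D) U i ->
  (forall i, D i -> A `&` U i !=set0) -> (forall i, D i -> connected (K i)) ->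
  (forall i j, D i -> D j -> U i `&` U j !=set0 -> K i `&` K j !=set0) ->
  connected (\bigcup_(i in D) K i).
Proof.
move=> ctA oU AU A0 ctK KK B [b Bb] [C oC BC] [C' cC' BC'].
have sub i : D i -> K i `&` B !=set0 -> K i `<=` B.
  move=> Di KB0; have cut W : B = \bigcup_(i in D) K i `&` W -> K i `&` B = K i `&` W.
    move=> ->; rewrite setIA; congr (_ `&` _).
    by apply/setIidPl => x Kx; exists i.
  apply/setIidPl; apply: ctK => //.
    by exists C => //; exact: cut.
  by exists C' => //; exact: cut.
pose G := [set i | D i /\ K i `&` B !=set0].
(* For [i] in [G] and [j] in [D] outside [G], [U i] and [U j] are disjoint: otherwise [K j] would
   meet [K i], which lies in [B]. The two open unions thus split [A]. *)
have GA : A `&` \bigcup_(i in G) U i = A.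
  apply: ctA.
  - have [i Di Kib] : (\bigcup_(i in D) K i) b by move: Bb; rewrite BC => -[].
    have [a [Aa Ua]] := A0 _ Di; exists a; split => //.
    by exists i => //; split => //; exists b.
  - exists (\bigcup_(i in G) U i) => //.
    by apply: bigcup_open => i [Di _]; exact: oU.
  - exists (~` \bigcup_(i in D `\` G) U i).
      by apply/open_closedC/bigcup_open => i [Di _]; exact: oU.
    apply/seteqP; split => x [Ax].
      move=> [i [Di Bi] Uix]; split => // -[j [Dj nGj] Ujx]; apply: nGj.
      have [|y [Kiy Kjy]] := KK i j Di Dj; first by exists x.
      by split => //; exists y; split => //; exact: (sub i).
    move=> nx; split => //; have [i Di Uix] := AU _ Ax.
    by exists i => //; apply: contrapT => nGi; apply: nx; exists i.
apply/seteqP; split => [x|x [i Di Kix]]; first by rewrite BC => -[].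
apply: (sub i) => //; have [a [Aa Uia]] := A0 _ Di.
have [_ [j [Dj Bj] Uja]] : (A `&` \bigcup_(i in G) U i) a by rewrite GA.
have [|y [Kiy Kjy]] := KK i j Di Dj; first by exists a.
by exists y; split => //; exact: (sub j).
Qed.

(* Finite subcovers, with "[D] is finite" replaced by an arbitrary property [Q]
   inherited by finite sets of indices. *)
Lemma compact_subcover_ind (T : topologicalType) (I : Type) (K : set T)
    (E : set I) (U : I -> set T) (Q : set (set I)) :
  compact K -> (forall i, E i -> open (U i)) -> K `<=` \bigcup_(i in E) U i ->
  Q set0 -> (forall i, E i -> Q [set i]) ->
  (forall D D', Q D -> Q D' -> Q (D `|` D')) ->
  exists2 D, Q D & K `<=` \bigcup_(i in D) U i.
Proof.
move=> /compact_near_coveringP cK oU KU Q0 Q1 QU.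
(* Neighborhoods of infinity among the index sets with [Q]; the near-covering form of compactness
   along [F] yields one that covers [K]. *)
pose F := filter_from Q (fun D => [set D' | Q D' /\ D `<=` D']).
have FF : Filter F.
  apply: filter_from_filter; first by exists set0.
  move=> D D' QD QD'; exists (D `|` D'); first exact: QU.
  by move=> W [QW]; rewrite subUset => -[].
have [D QD KD] : \forall D \near F, K `<=` (fun x => (\bigcup_(i in D) U i) x).
  apply: cK => x /KU[i Ei Ux]; exists (U i, [set D | Q D /\ [set i] `<=` D]).
    split => /=; first exact: open_nbhs_nbhs (conj (oU _ Ei) Ux).
    by exists [set i] => //; exact: Q1.
  by move=> [y D] /= [Uy [_ iD]]; exists i => //; exact: iD.
by exists D => //; apply: (KD D); split.
Qed.

Lemma nbhs_set_type (T : topologicalType) (S : set T) (x : S) (U : set S) :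
  nbhs x U <-> exists2 V, nbhs (set_val x) V & set_val @^-1` V `<=` U.
Proof.
split=> [[_ [[W oW <-] /= Wx WU]]|[V Vx VU]].
  by exists W => //; exact: open_nbhs_nbhs.
by apply: filterS VU _; exact: (@initial_continuous S T set_val x V Vx).
Qed.

Lemma set_val_inj (T : Type) (S : set T) : injective (@set_val T S).
Proof. by move=> x y; rewrite !set_valE => /val_inj. Qed.

Lemma set_val_surj (T : Type) (S : set T) x :
  S x -> exists y : S, set_val y = x.
Proof. by move=> /mem_set Sx; exists (SigSub Sx). Qed.

Lemma set_type_connected (T : topologicalType) (S : set T) (W : set S) :
  connected (set_val @` W) -> connected W.
Proof.
move=> ctW B [b Bb] [C [G1 oG1 G1C] BC] [C' /closed_openC[G2 oG2 G2C] BC'].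
have W1 x : G1 (set_val x) <-> C x by rewrite -G1C.
have W2 x : G2 (set_val x) <-> ~ C' x.
  by rewrite -[~ C' x]/((~` C') x) -G2C.
have BW : set_val @` B = set_val @` W.
  apply: ctW; first by exists (set_val b), b.
  - exists G1 => //; apply/seteqP; split=> [_ [x Bx <-]|_ [[x Wx <-]] /W1 Cx].
      by move: Bx; rewrite BC => -[Wx /W1 ?]; split => //; exists x.
    by exists x => //; rewrite BC.
  - exists (~` G2); first exact: open_closedC.
    apply/seteqP; split=> [_ [x Bx <-]|_ [[x Wx <-]] nO2].
      by move: Bx; rewrite BC' => -[Wx Cx]; split; [exists x|move/W2].
    by exists x => //; rewrite BC'; split => //; apply: contrapT => /W2.
apply/seteqP; split => [x|x Wx]; first by rewrite BC => -[].
have [y By /set_val_inj <-//] : (set_val @` B) (set_val x) by rewrite BW; exists x.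
Qed.

Lemma set_type_compact (T : topologicalType) (S : set T) :
  compact S -> compact [set: S].
Proof.
move=> /compact_near_coveringP cS; apply/compact_near_coveringP.
move=> I F P FF H.
have : \forall i \near F, S `<=` (fun y => forall x : S, set_val x = y -> P i x).
  apply: cS => v Sv; have [x <-] := set_val_surj Sv.
  have [[U V] [/= /nbhs_set_type[W Wx WU] FV] UV] := H x Logic.I.
  exists (W, V) => // -[y i] [/= Wy Vi] z zy.
  by apply: (UV (z, i)); split => //=; apply: WU; rewrite /= zy.
by apply: filterS => i Si x _; apply: (Si (set_val x)) => //; exact: set_valP.
Qed.

Lemma set_type_metrizable (R : realType) (T : metricType R) (S : set T) :
  metrizable R S.
Proof.
exists (fun x y : S => mdist (set_val x) (set_val y)); split.
- by move=> x y; split => [/mdist_positivity/set_val_inj|->]; [|exact: mdistxx].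
- by move=> x y; exact: metric_sym.
- by move=> x y z; exact: metric_triangle.
- move=> x V; rewrite nbhs_set_type; split=> [[W /nbhs_ballP[e /= e0 eW] WV]|[e e0 eV]].
    by exists e => // y; rewrite /= => xy; apply: WV; apply: eW; rewrite ballEmdist.
  exists (ball (set_val x) e); first exact: nbhsx_ballx.
  by move=> y; rewrite ballEmdist; exact: eV.
Qed.

End general_topology.

(** * Level members avoiding small balls *)

Section colocal.
Context {R : realType} {X : metricType R} {cX : continuum R X}.
Context {mu : hyperspace X -> R} (muW : whitney_map cX mu).
Implicit Types (A B C D E F : hyperspace X) (e r s : R).
Context {t : R} (t0X : 0 <= t < mu (whole cX)).
Context (colocal : forall (x : X) (V : set X), nbhs x V ->
  exists U : set X, [/\ open U, U x, U `<=` V & connected (~` U)]).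

Notation level Y := (level_in mu Y t).

Let cpX : compact [set: X]. Proof. by case: cX. Qed.

Lemma whole_not_set1 (x : X) : exists y, y <> x.
Proof.
apply: contrapT => all_x.
have : mu (whole cX) <= mu (singleton x).
  apply: (whitney_le muW) => y _; apply: contrapT => yx; apply: all_x.
  by exists y.
by case/andP: t0X => t0 tX; rewrite (whitney_singleton muW); lra.
Qed.

(** Deleting a tiny [U] around [x] leaves a continuum so close to [X] that its [mu] still exceeds
    [t]; a level member is found inside it. *)
Lemma level_avoid (x : X) : exists2 D, level setT D & ~ carrier D x.
Proof.
have [t0 tX] := andP t0X.
have dX0 : 0 < mu (whole cX) - t by rewrite subr_gt0.
have [e e0 He] := whitney_near muW (whole cX) dX0.
have e40 : 0 < e / 2 / 2 by rewrite !divr_gt0.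
(* The connected nondegenerate [X] has no isolated point. Keeping a nearby [y] out of [U] makes the
   complement nonempty and puts each point of [U] within [e / 2] of it. *)
have [y xy yx] : exists2 y, ball x (e / 2 / 2) y & y <> x.
  apply: contrapT => iso; have [y yx] := whole_not_set1 x; apply: yx.
  have [_ _ ctX _] := cX.
  apply: (connected_chained e40 ctX (P := [set x])) => //; first by exists x.
  move=> _ z -> _ xz; apply: contrapT => zx; apply: iso.
  by exists z.
have nbhsV : nbhs x (ball x (e / 2 / 2) `&` ~` [set y]).
  apply: filterI; first exact: nbhsx_ballx.
  apply: open_nbhs_nbhs; split; last by move=> /= /esym.
  apply: closed_openC; apply: metric_compact_closed; exact: compact_set1.
have [U [oU Ux UV ctU]] := colocal nbhsV.
have Uy : (~` U) y by move=> /UV[_]; exact.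
have scU : subcontinuum (~` U).
  split => //; first by exists y.
  by apply: subclosed_compact (open_closedC oU) cpX _.
pose E := Hyperspace scU.
have : ball (whole cX) e E.
  apply: (@sub_ball_hyperspace _ _ _ _ _ (e / 2)); [lra|lra| |].
    move=> z _; have [Uz|nUz] := pselect (U z); last by exists z => //; apply: ballxx; lra.
    exists y => //; have [xz _] := UV _ Uz.
    by rewrite (splitr (e / 2)); exact: ball_triangle (ball_sym xy) xz.
  by move=> z _; exists z => //; apply: ballxx; lra.
move=> /He/ltr_distlBl => tE.
have t0E : 0 <= t <= mu E by lra.
have [D [DE Dt] _] := whitney_intermediate muW (Y := E) Uy t0E.
by exists D; [split|move=> /DE; apply].
Qed.

Lemma level_avoid_ball : \forall r \near 0^'+,
  forall x : X, exists2 D, level setT D & carrier D `&` ball x r = set0.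
Proof.
have /compact_near_coveringP cpXn := cpX.
have : \forall r \near 0^'+, [set: X] `<=`
    (fun x => exists2 D, level setT D & carrier D `&` ball x r = set0).
  apply: cpXn => x _; have [D lD nDx] := level_avoid x.
  have /nbhs_ballP[r /= r0 rD] : nbhs x (~` (D : set X)).
    by apply: open_nbhs_nbhs; split => //; exact/closed_openC/hyperspace_closed.
  near=> y s; exists D => //; apply/seteqP; split => // z [Dz yz].
  apply: (rD z) => //; rewrite (splitr r); apply: (@ball_triangle _ _ y).
    by near: y; apply: near_ball; rewrite divr_gt0.
  have sr : s <= r / 2 by near: s; apply: nbhs_right_le; rewrite divr_gt0.
  exact: le_ball yz.
by apply: filterS => r H x; exact: H.
Unshelve. all: by end_near. Qed.

End colocal.

(** * Colocal connectedness of the level *)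

Theorem theorem3p2 (R : realType) :
  whitney_property R (colocally_connected R).
Proof.
move=> X cX [_ colocal] mu muW t t0X.
have [[x0 _] cpX _ _] := cX; have [t0 tX] := andP t0X.
have levelE : [set A : hyperspace X | mu A = t] = level_in mu setT t.
  by apply/seteqP; split => [A At|A []].
split.
  split.
  - have t0X' : 0 <= t <= mu (whole cX) by rewrite t0 ltW.
    have [A [_ At] _] :=
      whitney_intermediate muW (Y := whole cX) (x := x0) Logic.I t0X'.
    by have [y _] := set_val_surj (At : (mu @^-1` [set t]) A); exists y.
  - apply: set_type_compact; rewrite [X in compact X]levelE.
    by apply: (level_in_compact muW); exact: closedT.
  - apply: set_type_connected.
    rewrite (_ : _ @` _ = level_in mu setT t).
      exact: (level_in_connected muW (whole cX) t).
    apply/seteqP; split=> [_ [A _ <-]|A [_ At]].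
      by split => //; exact: (set_valP A).
    by have [y yA] := set_val_surj (At : (mu @^-1` [set t]) A); exists y.
  - exact: set_type_metrizable.
move=> x V /nbhs_set_type[W /nbhs_ballP[e /= e0 eW] WV].
set A : hyperspace X := set_val x in eW *.
have At : mu A = t := set_valP x.
have [d d0 close] := whitney_closer muW e0.
(* Each [U b] will lie in a ball of radius [r], so a member avoiding the ball of radius [r + r]
   about a common point of [U b] and [U c] lies in both [K b] and [K c]. *)
have [r [r0 rd avoid]] : exists r, [/\ 0 < r, r + r <= d & forall x : X,
    exists2 D, level_in mu setT t D & carrier D `&` ball x (r + r) = set0].
  have [s s0 [savoid sd]] := at_right0_ex (filterI
    (level_avoid_ball muW t0X colocal) (nbhs_right_le d0)).
  by exists (s / 2); rewrite -splitr divr_gt0.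
have /choice[U UP] (b : X) : exists U : set X,
    [/\ open U, U b, U `<=` ball b r & connected (~` U)].
  by apply: colocal; exact: nbhsx_ballx.
pose K b := level_in mu (~` U b) t.
have [_ cA ctA] := carrierP A.
have UA b : U b b by have [] := UP b.
have oU b : open (U b) by have [] := UP b.
have Ur b : U b `<=` ball b r by have [] := UP b.
have level_K b z D : U b z -> level_in mu setT t D ->
    carrier D `&` ball z (r + r) = set0 -> K b D.
  move=> Ubz [_ Dt] Dz; split => // y Dy Uby.
  suff : (carrier D `&` ball z (r + r)) y by rewrite Dz.
  split => //; exact: ball_triangle (ball_sym (Ur _ _ Ubz)) (Ur _ _ Uby).
have ctK b : connected (K b).
  have [D lD /(level_K _ _ _ (UA b) lD)[DU _]] := avoid b.
  have scU : subcontinuum (~` U b).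
    have [_ _ _ ctU] := UP b; split => //.
      by have [[y /DU ?] _ _] := carrierP D; exists y.
    by apply: subclosed_compact (open_closedC (oU b)) cpX _.
  exact: (level_in_connected muW (Hyperspace scU) t).
(* The neighborhood condition holds for single indices and is stable under unions, so it stands in
   for finiteness of [D]. *)
have [D [DA DnbhsA] AD] : exists2 D : set X,
      D `<=` A /\ nbhs A [set B : hyperspace X |
        forall b, D b -> carrier B `&` U b !=set0] &
    (A : set X) `<=` \bigcup_(b in D) U b.
  apply: (@compact_subcover_ind _ _ _ (A : set X)) => //.
  - by move=> b Ab; exists b.
  - split; first exact: sub0set.
    by apply: filterS filterT => B _ b [].
  - move=> b Ab; split; first by move=> _ ->.
    have /nbhs_ballP[s /= s0 sU] : nbhs b (U b) by exact: open_nbhs_nbhs.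
    apply/nbhs_ballP; exists s => // B /ball_hyperspace_sub[/(_ _ Ab)[y By yb] _] _ ->.
    by exists y; split => //; apply: sU; exact: ball_sym.
  - move=> D D' [DA DU] [D'A D'U]; split; first by rewrite subUset.
    by apply: filterS (filterI DU D'U) => B [BD BD'] b [/BD|/BD'].
pose KD := \bigcup_(b in D) K b.
have ctKD : connected KD.
  apply: (nerve_connected ctA) AD _ _ _ => //.
  - by move=> b /DA Ab; exists b.
  - move=> b c Db Dc [z [Ubz Ucz]]; have [E lE Ez] := avoid z.
    by exists E; split; exact: level_K Ez.
(* The closure taken in the hyperspace stays in the closed level, so it is exactly the complement of
   the neighborhood built below. *)
have KDt : closure KD `<=` level_in mu setT t.
  apply: (@subset_trans _ (closure (level_in mu setT t))).
    by apply: closureS => B [b _ [_ Bt]].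
  by apply: (level_in_closed muW); exact: closedT.
exists (set_val @^-1` (~` closure KD)); split.
- by exists (~` closure KD) => //; apply: closed_openC; exact: closed_closure.
- by move=> /(_ _ DnbhsA)[B [[b Db [BU _]] /(_ _ Db)[y [/BU]]]].
(* Outside [KD], [y] meets every [U b] with [b] in [D]; these cover [A], and points of one [U b] are
   less than [r + r <= d] apart, so [A] lies in the [d]-neighborhood of [y]. *)
- move=> y nKDy; apply: WV; apply: eW; apply: close; last first.
    by rewrite At (set_valP y : mu _ = t).
  move=> a /AD[b Db Uba]; apply: contrapT => far; apply: nKDy.
  apply: subset_closure; exists b => //; split; last exact: (set_valP y).
  move=> z yz Ubz; apply: far; exists z => //; apply: le_ball rd _ _.
  exact: ball_triangle (ball_sym (Ur _ _ Ubz)) (Ur _ _ Uba).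
- apply: set_type_connected.
  rewrite (_ : _ @` _ = closure KD); first exact: connected_closure.
  apply/seteqP; split=> [_ [y nny <-]|B KB]; first exact: contrapT nny.
  have [y yB] := set_val_surj ((KDt _ KB).2 : (mu @^-1` [set t]) B).
  by exists y; rewrite //= yB; apply.
Qed.
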